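(* Let $1\le q=r<p<\infty$, $\lambda_0>0$, $\lambda_j\ge0$, $j=1,\ldots,n$, and put $\sigma_q(t)=\sum_{j=1}^n\lambda_j|\varphi_j(t)|^q$ and $$\widehat x(t)=\begin{cases}\left(\dfrac q{p\lambda_0}\bigl(|\psi(t)|^q-\sigma_q(t)\bigr)_+\right)^{\frac1{p-q}},&t\in T_0,\\ 0,&t\notin T_0.\end{cases}$$ Suppose that $(\lambda_0,\ldots,\lambda_n)$ satisfies $$\int_{T_0}\widehat x^p(t)\,d\mu(t)\le\delta^p,\qquad \int_T|\varphi_j(t)|^q\widehat x^q(t)\,d\mu(t)\le1,\quad j=1,\ldots,n,$$ $$\lambda_0\Bigl(\int_{T_0}\widehat x^p(t)\,d\mu(t)-\delta^p\Bigr)=0,\qquad \lambda_j\Bigl(\int_T|\varphi_j(t)|^q\widehat x^q(t)\,d\mu(t)-1\Bigr)=0,\quad j=1,\ldots,n,$$ and that $|\psi(t)|^q-\sigma_q(t)\le0$ for almost all $t\notin T_0$. Then $$E(p,q,q)=\Bigl(q^{-1}p\lambda_0\delta^p+\sum_{j=1}^n\lambda_j\Bigr)^{1/q},$$ and the method $$\widehat m(y)(t)=\begin{cases}\bigl(1-|\psi(t)|^{-q}\sigma_q(t)\bigr)_+\psi(t)y(t),&t\in T_0,\ \psi(t)\ne0,\\ 0,&\text{otherwise},\end{cases}$$ is optimal.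
   Context: $a_+=\max\{a,0\}$. $(T,\Sigma,\mu)$ is a nonempty set with a $\sigma$-algebra $\Sigma$ and a nonnegative $\sigma$-additive measure $\mu$; $L_p(T,\mu)$ denotes the $\Sigma$-measurable functions with values in $\mathbb R$ or $\mathbb C$ with finite norm $\|x\|_{L_p(T,\mu)}=(\int_T|x|^p\,d\mu)^{1/p}$ (essential supremum for $p=\infty$). $T_0\subset T$ is a nonempty $\mu$-measurable subset, $\psi,\varphi_1,\ldots,\varphi_n$ are measurable functions on $T$, and $\delta>0$. Put $$\mathcal W=\{x:\ x\in L_p(T_0,\mu),\ \|\varphi_jx\|_{L_r(T,\mu)}<\infty,\ j=1,\ldots,n\},\quad W=\{x\in\mathcal W:\ \|\varphi_jx\|_{L_r(T,\mu)}\le1,\ j=1,\ldots,n\}$$ (here $x$ is a measurable function on $T$). It is assumed that $\Lambda x:=\psi x\in L_q(T,\mu)$ for all $x\in\mathcal W$. A recovery method is an arbitrary map $m\colon L_p(T_0,\mu)\to L_q(T,\mu)$; its error is $$e(p,q,r,m)=\sup\{\|\Lambda x-m(y)\|_{L_q(T,\mu)}:\ x\in W,\ y\in L_p(T_0,\mu),\ \|x-y\|_{L_p(T_0,\mu)}\le\delta\}.$$ The optimal recovery error is $E(p,q,r)=\inf_m e(p,q,r,m)$ over all methods $m$, and a method attaining this infimum is called optimal. Here $r=q$. *)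

(* Defs.v *)
From HB Require Import structures.
From mathcomp Require Import all_boot all_order all_algebra.
From mathcomp Require Import complex.
From mathcomp Require Import all_classical all_reals all_analysis.

Set Implicit Arguments.
Unset Strict Implicit.
Unset Printing Implicit Defensive.

Import Order.TTheory GRing.Theory Num.Theory.
Import numFieldNormedType.Exports.

Local Open Scope classical_set_scope.
Local Open Scope ring_scope.

(** The function spaces consist of real-valued or of complex-valued functions;
    every definition below takes the choice as a parameter. *)
Inductive scalar_kind := RealScalars | ComplexScalars.

Definition scalar_field (R : realType) (k : scalar_kind) : numFieldType :=
  match k with RealScalars => R | ComplexScalars => R[i] end.

(** The modulus, valued in [R]: the library norm of [R[i]] is valued in [R[i]],
    with zero imaginary part. *)
Definition modulus (R : realType) (k : scalar_kind) : scalar_field R k -> R :=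
  match k with
  | RealScalars => fun x : R => `|x|
  | ComplexScalars => fun z : R[i] => complex.Re `|z|
  end.

Definition of_real (R : realType) (k : scalar_kind) : R -> scalar_field R k :=
  match k with
  | RealScalars => fun a : R => a
  | ComplexScalars => fun a : R => (a%:C)%C
  end.

(** [R[i]] carries no measurable structure in the library; measurability with
    respect to its Borel sets is measurability of both components. *)
Definition smeasurable (R : realType) (k : scalar_kind) (d : measure_display)
    (T : measurableType d) : set T -> (T -> scalar_field R k) -> Prop :=
  match k with
  | RealScalars => fun D (f : T -> R) => measurable_fun D f
  | ComplexScalars => fun D (f : T -> R[i]) =>
      measurable_fun D (fun t => complex.Re (f t)) /\
      measurable_fun D (fun t => complex.Im (f t))
  end.

Definition pospart (R : realType) (a : R) : R := Num.max a 0.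

Section Spaces.
Context (R : realType) (k : scalar_kind) (d : measure_display).
Context (T : measurableType d) (mu : {measure set T -> \bar R}).
Implicit Types (D : set T) (p : \bar R) (f : T -> scalar_field R k).

(** The norm of [L_p(D, mu)], by extension by zero outside [D]; [Lnorm] is the
    essential supremum when [p = +oo]. *)
Definition Lp_norm D p f : \bar R :=
  ('N[mu]_p[(fun t => (modulus (f t))%:E) \_ D])%E.

(** Elements of [L_p(D, mu)] are represented by functions on all of [T] whose
    values outside [D] are irrelevant. *)
Definition in_Lp D p f : Prop :=
  smeasurable D f /\ (Lp_norm D p f < +oo)%E.

End Spaces.

Section Recovery.
Context (R : realType) (k : scalar_kind) (d : measure_display).
Context (T : measurableType d) (mu : {measure set T -> \bar R}).
Context (T0 : set T) (n : nat).
Context (psi : T -> scalar_field R k) (phi : 'I_n -> T -> scalar_field R k) (delta : R).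
Implicit Types (p q r : \bar R) (x y : T -> scalar_field R k).

Definition calW p r x : Prop :=
  [/\ smeasurable setT x, in_Lp mu T0 p x &
      forall j, (Lp_norm mu setT r (fun t => phi j t * x t)%R < +oo)%E].

Definition classW p r x : Prop :=
  calW p r x /\
  forall j, (Lp_norm mu setT r (fun t => phi j t * x t)%R <= 1)%E.

(** Arbitrary maps [L_p(T0, mu) -> L_q(T, mu)].  Elements of these spaces are
    identified when they are equal almost everywhere (on [T0], resp. on [T]),
    so a map between them is a function on representatives which respects this
    identification; its values off [L_p(T0, mu)] play no role. *)
Definition is_method p q (m : (T -> scalar_field R k) -> (T -> scalar_field R k)) : Prop :=
  (forall y, in_Lp mu T0 p y -> in_Lp mu setT q (m y)) /\
  (forall y1 y2, in_Lp mu T0 p y1 -> in_Lp mu T0 p y2 ->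
     ae_eq mu T0 y1 y2 -> ae_eq mu setT (m y1) (m y2)).

Definition method_error p q r (m : (T -> scalar_field R k) -> (T -> scalar_field R k)) :
    \bar R :=
  ereal_sup [set e | exists x y,
    [/\ classW p r x, in_Lp mu T0 p y,
        (Lp_norm mu T0 p (fun t => x t - y t)%R <= delta%:E)%E &
        e = Lp_norm mu setT q (fun t => psi t * x t - m y t)]].

Definition optimal_error p q r : \bar R :=
  ereal_inf [set method_error p q r m | m in is_method p q].

Definition optimal_method p q r (m : (T -> scalar_field R k) -> (T -> scalar_field R k)) :
    Prop :=
  is_method p q m /\ method_error p q r m = optimal_error p q r.

End Recovery.

Section Extremal.
Context (R : realType) (k : scalar_kind) (T : Type) (T0 : set T) (n : nat).
Context (psi : T -> scalar_field R k) (phi : 'I_n -> T -> scalar_field R k).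
Context (p q lambda0 : R) (lambda : 'I_n -> R).

Definition sigma (t : T) : R :=
  \sum_(j < n) lambda j * modulus (phi j t) `^ q.

Definition xhat (t : T) : R :=
  if t \in T0 then
    (q / (p * lambda0) * pospart (modulus (psi t) `^ q - sigma t))
      `^ (p - q)^-1
  else 0.

Definition mhat (y : T -> scalar_field R k) (t : T) : scalar_field R k :=
  if (t \in T0) && (psi t != 0) then
    of_real k (pospart (1 - modulus (psi t) `^ (- q) * sigma t))
      * psi t * y t
  else 0.

End Extremal.

(* Main.v *)
(** Lower bound: [xhat] and [- xhat] both lie in [W] and are both compatible with
    the data [y = 0], so every method errs by at least the norm of [psi * xhat],
    whose [q]-th power is [p lambda0 delta^p / q + \sum_j lambda_j] by
    complementary slackness.

    Upper bound: where [|psi|^q > sigma], with [theta = sigma / |psi|^q],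
      [psi x - mhat y = psi (theta x + (1 - theta) (x - y))],
    so convexity of [u^q] gives, with [c = (|psi|^q - sigma)_+],
      [|psi x - mhat y|^q <= sigma |x|^q + c |x - y|^q].
    As [c = (p lambda0 / q) xhat^(p - q)], Young's inequality turns the last term
    into [(p lambda0 / q) ((1 - q/p) xhat^p + (q/p) |x - y|^p)]; now integrate. *)

Require Import Defs.
From HB Require Import structures.
From mathcomp Require Import all_boot all_order all_algebra.
From mathcomp Require Import complex.
From mathcomp Require Import all_classical all_reals all_analysis.
From mathcomp Require Import measurable_realfun.
From mathcomp Require Import ring lra.

Set Implicit Arguments.
Unset Strict Implicit.
Unset Printing Implicit Defensive.

Import Order.TTheory GRing.Theory Num.Theory.
Import numFieldNormedType.Exports.

Local Open Scope classical_set_scope.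
Local Open Scope ring_scope.

(** * The modulus, treated uniformly for real and complex scalars *)

Section Modulus.
Context (R : realType) (k : scalar_kind).
Implicit Types (z w : scalar_field R k) (a : R).

Lemma modulus_complexE (z : R[i]) : @modulus R ComplexScalars z =
  Num.sqrt (complex.Re z ^+ 2 + complex.Im z ^+ 2).
Proof. by case: z. Qed.

Lemma modulus_ge0 z : 0 <= modulus z.
Proof.
case: k z => z; first exact: normr_ge0.
by rewrite modulus_complexE sqrtr_ge0.
Qed.

Lemma modulus0 : modulus (0 : scalar_field R k) = 0.
Proof. by case: k; [exact: normr0|exact: Normc.normc0]. Qed.

Lemma modulus0_eq0 z : modulus z = 0 -> z = 0.
Proof. by case: k z => z; [exact: normr0_eq0|exact: Normc.eq0_normc]. Qed.

Lemma modulusM z w : modulus (z * w) = modulus z * modulus w.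
Proof. by case: k z w => z w; [exact: normrM|exact: Normc.normcM]. Qed.

Lemma modulusN z : modulus (- z) = modulus z.
Proof. by case: k z => z; [exact: normrN|exact: normcN]. Qed.

Lemma ler_modulusD z w : modulus (z + w) <= modulus z + modulus w.
Proof. by case: k z w => z w; [exact: ler_normD|exact: le_normcD]. Qed.

Lemma modulus_of_real a : modulus (of_real k a) = `|a|.
Proof.
case: k => //; rewrite modulus_complexE /= expr0n/= addr0.
exact: sqrtr_sqr.
Qed.

Lemma of_realB a b : of_real k (a - b) = of_real k a - of_real k b.
Proof. by case: k => //=; rewrite rmorphB. Qed.

Lemma of_real0 : of_real k (0 : R) = 0.
Proof. by case: k. Qed.

Lemma of_real1 : of_real k (1 : R) = 1.
Proof. by case: k. Qed.

End Modulus.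

(** * Measurability of scalar-valued functions *)

Section Smeasurable.
Context (R : realType) (k : scalar_kind) (d : measure_display).
Context (T : measurableType d).
Implicit Types (D : set T) (f g : T -> scalar_field R k).

Lemma smeasurableS D E f : measurable E -> D `<=` E ->
  smeasurable E f -> smeasurable D f.
Proof.
move=> mE DE; case: k f => /= f; first exact: measurable_funS.
by case=> mr mi; split; [exact: measurable_funS mr|exact: measurable_funS mi].
Qed.

Lemma smeasurableM D f g : smeasurable D f -> smeasurable D g ->
  smeasurable D (fun t => f t * g t).
Proof.
case: k f g => /= f g; first exact: measurable_funM.
move=> [fr fi] [gr gi]; split.
  rewrite (_ : (fun _ => _) = fun t =>
    complex.Re (f t) * complex.Re (g t) - complex.Im (f t) * complex.Im (g t)).
    by apply: measurable_funB; exact: measurable_funM.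
  by apply/funext => t; case: (f t) => a b; case: (g t).
rewrite (_ : (fun _ => _) = fun t =>
  complex.Re (f t) * complex.Im (g t) + complex.Im (f t) * complex.Re (g t)).
  by apply: measurable_funD; exact: measurable_funM.
by apply/funext => t; case: (f t) => a b; case: (g t).
Qed.

Lemma smeasurableB D f g : smeasurable D f -> smeasurable D g ->
  smeasurable D (fun t => f t - g t).
Proof.
case: k f g => /= f g; first exact: measurable_funB.
move=> [fr fi] [gr gi]; split.
  rewrite (_ : (fun _ => _) = fun t => complex.Re (f t) - complex.Re (g t)).
    exact: measurable_funB.
  by apply/funext => t; case: (f t) => a b; case: (g t).
rewrite (_ : (fun _ => _) = fun t => complex.Im (f t) - complex.Im (g t)).
  exact: measurable_funB.
by apply/funext => t; case: (f t) => a b; case: (g t).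
Qed.

Lemma smeasurable0 D : smeasurable D (fun=> 0 : scalar_field R k).
Proof. by case: k => /=; [|split]; exact: measurable_cst. Qed.

Lemma smeasurableN D f : smeasurable D f -> smeasurable D (fun t => - f t).
Proof.
move=> mf; rewrite (_ : (fun _ => _) = fun t => 0 - f t).
  by apply: smeasurableB => //; exact: smeasurable0.
by apply/funext => t; rewrite sub0r.
Qed.

Lemma smeasurable_of_real D (h : T -> R) : measurable_fun D h ->
  smeasurable D (fun t => of_real k (h t)).
Proof. by case: k => //= mh; split => //; exact: measurable_cst. Qed.

(** Serves [mhat]: the data are measurable only on [T0], while the recovered function has to be
    measurable on the whole space. *)
Lemma smeasurable_extend0 D f : measurable D -> smeasurable D f ->
  smeasurable setT (fun t => if t \in D then f t else 0).
Proof.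
move=> mD; case: k f => /= f.
  by move/(measurable_restrictT f mD); rewrite /patch.
move=> [/(measurable_restrictT _ mD) mr /(measurable_restrictT _ mD) mi].
split.
  by apply: eq_measurable_fun mr => t _; rewrite /patch; case: ifP.
by apply: eq_measurable_fun mi => t _; rewrite /patch; case: ifP.
Qed.

Lemma measurable_modulus D f : smeasurable D f ->
  measurable_fun D (fun t => modulus (f t)).
Proof.
case: k f => /= f; first exact: measurableT_comp.
move=> [fr fi].
(* The square root is written as a power with exponent 1/2, so that measurability of [powR]
   applies. *)
rewrite (_ : (fun _ => _) = fun t =>
  (complex.Re (f t) ^+ 2 + complex.Im (f t) ^+ 2) `^ 2^-1); last first.
  apply/funext => t.
  rewrite -[LHS]/(@modulus R ComplexScalars (f t)) modulus_complexE powR12_sqrt//.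
  by rewrite addr_ge0// sqr_ge0.
apply: (measurableT_comp (measurable_powR _)).
by apply: measurable_funD; exact: measurable_funX.
Qed.

Lemma measurable_modulus_powR D f r : smeasurable D f ->
  measurable_fun D (fun t => modulus (f t) `^ r).
Proof.
by move=> mf; apply: (measurableT_comp (measurable_powR _)); exact: measurable_modulus.
Qed.

End Smeasurable.

(** * Pointwise inequalities: convexity, Young, and the error of the filter *)

Section Pointwise.
Context (R : realType).
Implicit Types (p q a b c s t u : R).

Lemma pospart_ge0 a : 0 <= pospart a.
Proof. by rewrite /pospart le_max lexx orbT. Qed.

Lemma pospart_le0 a : a <= 0 -> pospart a = 0.
Proof. by rewrite /pospart => a0; exact/max_idPr. Qed.

Lemma pospart_ge0E a : 0 <= a -> pospart a = a.
Proof. by rewrite /pospart => a0; exact/max_idPl. Qed.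

Lemma ler_powR_conv q a b t : 1 <= q -> 0 <= a -> 0 <= b -> 0 <= t -> t <= 1 ->
  (t * a + (1 - t) * b) `^ q <= t * a `^ q + (1 - t) * b `^ q.
Proof.
move=> q1 a0 b0 t0 t1.
by apply: (convex_powR q1 (Itv01 t0 t1)) => //=; rewrite inE/= in_itv/= ?a0 ?b0.
Qed.

(** Midpoint convexity after monotonicity of the power. In the lower bound, [a] and [b] are the
    errors at two opposite functions and [2 * c] is the distance between their images. *)
Lemma ler_powR_half_sum q a b c : 1 <= q -> 0 <= a -> 0 <= b -> 0 <= c ->
  2 * c <= a + b -> c `^ q <= 2^-1 * (a `^ q + b `^ q).
Proof.
move=> q1 a0 b0 c0 cab.
have h : (2^-1 : R) = 1 - 2^-1 by lra.
apply: (@le_trans _ _ ((2^-1 * a + (1 - 2^-1) * b) `^ q)).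
  by apply: ge0_ler_powR; rewrite ?nnegrE//; lra.
apply: le_trans (ler_powR_conv q1 a0 b0 _ _) _; [lra|lra|].
by rewrite -h mulrDr.
Qed.

Section Multiplier.
Context (p q lambda0 : R).
Hypotheses (q_ge1 : 1 <= q) (q_lt_p : q < p) (lambda0_gt0 : 0 < lambda0).

Let q_gt0 : 0 < q. Proof. exact: lt_le_trans q_ge1. Qed.
Let p_gt0 : 0 < p. Proof. exact: lt_trans q_lt_p. Qed.

(** The point where c u^q - lambda0 u^p is largest over u >= 0, found by setting the derivative to
    zero. On [T0] it is the value of [xhat] when c is the positive part of |psi|^q - sigma. *)
Definition multiplier_root c := (q / (p * lambda0) * c) `^ (p - q)^-1.

Lemma multiplier_rootX c : 0 <= c ->
  multiplier_root c `^ (p - q) = q / (p * lambda0) * c.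
Proof.
move=> c0; rewrite -powRrM mulVf ?subr_eq0 ?gt_eqF// powRr1//.
by rewrite mulr_ge0// divr_ge0 ?mulr_ge0 ?ltW.
Qed.

Lemma multiplierE c : 0 <= c ->
  c = q^-1 * p * lambda0 * multiplier_root c `^ (p - q).
Proof.
move=> c0; rewrite multiplier_rootX//; field.
by rewrite !gt_eqF.
Qed.

(** Write h for the root and c = K h^(p-q) with K = p lambda0 / q. Young's inequality is applied to
    h^(p-q) and u^q with the conjugate exponents p/(p-q) and p/q, which turn both factors into p-th
    powers. Equality holds at u = h, so nothing is lost at the extremal function. *)
Lemma multiplier_young c u : 0 <= c -> 0 <= u ->
  c * u `^ q <= q^-1 * p * lambda0 *
    ((1 - q / p) * multiplier_root c `^ p + q / p * u `^ p).
Proof.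
move=> c0 u0; rewrite {1}(multiplierE c0) -[leLHS]mulrA ler_wpM2l//.
  by rewrite !mulr_ge0 ?invr_ge0 ?ltW.
have pq0 : 0 < p - q by rewrite subr_gt0.
have := @conjugate_powR R (multiplier_root c `^ (p - q)) (u `^ q)
  (p / (p - q)) (p / q) (powR_ge0 _ _) (powR_ge0 _ _) (divr_gt0 p_gt0 pq0)
  (divr_gt0 p_gt0 q_gt0).
rewrite -!powRrM (mulrCA (p - q)) divff ?gt_eqF// (mulrCA q) divff ?gt_eqF//.
rewrite !mulr1 !invf_div (mulrC _ ((p - q) / p)) (mulrC _ (q / p)).
rewrite mulrBl divff ?gt_eqF// subrK.
exact.
Qed.

(** Where a > s, this is the equation a - s = K h^(p-q) multiplied by h^q, with K = p lambda0 / q.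
    Where a <= s, the root is a power of 0 with nonzero exponent, hence 0, and every term
    vanishes. *)
Lemma multiplier_root_stationary a s : 0 <= a ->
  a * multiplier_root (pospart (a - s)) `^ q =
  s * multiplier_root (pospart (a - s)) `^ q +
  q^-1 * p * lambda0 * multiplier_root (pospart (a - s)) `^ p.
Proof.
move=> a0; have [as0|as0] := leP (a - s) 0.
  rewrite pospart_le0// /multiplier_root mulr0.
  by rewrite !powR0 ?mulr0 ?addr0// ?invr_eq0 ?subr_eq0 gt_eqF.
rewrite pospart_ge0E ?(ltW as0)//; set h := multiplier_root _.
have h0 : 0 < h.
  by rewrite powR_gt0// mulr_gt0// divr_gt0// mulr_gt0.
have : a - s = q^-1 * p * lambda0 * h `^ (p - q) by exact/multiplierE/ltW.
have -> : h `^ p = h `^ (p - q) * h `^ q.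
  by rewrite -powRD ?subrK// (gt_eqF p_gt0).
by move=> e; rewrite mulrA -e -mulrDl (addrC s) subrK.
Qed.

End Multiplier.

(** Three cases. If psi = 0, the left side is 0. If |psi|^q <= s, the filter is 0 and only |psi x|^q
    <= s |x|^q remains. Otherwise the error is psi times a convex combination of x and x - y with
    weight s / |psi|^q on x, and convexity of the q-th power concludes. *)
Lemma modulus_filtered_error (k : scalar_kind) q s (psi x y : scalar_field R k) :
  1 <= q -> 0 <= s ->
  modulus (psi * x -
    of_real k (pospart (1 - modulus psi `^ (- q) * s)) * psi * y) `^ q <=
  s * modulus x `^ q + pospart (modulus psi `^ q - s) * modulus (x - y) `^ q.
Proof.
move=> q1 s0; have q0 : 0 < q by exact: lt_le_trans q1.
have [psi0|psi0] := eqVneq psi 0.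
  rewrite psi0 !(mul0r, mulr0) subr0 modulus0 powR0 ?gt_eqF//.
  by rewrite addr_ge0// mulr_ge0// ?powR_ge0// pospart_ge0.
set A := modulus psi `^ q.
have A0 : 0 < A.
  rewrite powR_gt0// lt0r modulus_ge0 andbT.
  by apply: contra_neq psi0 => /modulus0_eq0.
rewrite powRN -/A (mulrC A^-1).
have [As|As] := leP A s.
  rewrite pospart_le0; last by rewrite subr_le0 ler_pdivlMr// mul1r.
  rewrite of_real0 !mul0r subr0 pospart_le0 ?subr_le0// mul0r addr0.
  by rewrite modulusM powRM ?modulus_ge0// ler_wpM2r// powR_ge0.
have th0 : 0 <= s / A by rewrite divr_ge0// ltW.
have th1 : s / A <= 1 by rewrite ler_pdivrMr// mul1r ltW.
rewrite !pospart_ge0E ?subr_ge0 ?(ltW As)//.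
have -> : psi * x - of_real k (1 - s / A) * psi * y =
    psi * (of_real k (s / A) * x + of_real k (1 - s / A) * (x - y)).
  by rewrite of_realB of_real1; ring.
rewrite modulusM powRM ?modulus_ge0// -/A.
have -> : s * modulus x `^ q + (A - s) * modulus (x - y) `^ q =
    A * (s / A * modulus x `^ q + (1 - s / A) * modulus (x - y) `^ q).
  by field; rewrite gt_eqF.
rewrite ler_wpM2l ?(ltW A0)//.
apply: le_trans (ler_powR_conv q1 _ _ th0 th1); rewrite ?modulus_ge0//.
rewrite ge0_ler_powR ?(ltW q0) ?nnegrE ?modulus_ge0//.
  by rewrite addr_ge0// mulr_ge0 ?modulus_ge0// subr_ge0.
apply: le_trans (ler_modulusD _ _) _.
by rewrite !modulusM !modulus_of_real !ger0_norm ?subr_ge0.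
Qed.

End Pointwise.

(** * Norm bounds as bounds on integrals of powers *)

Lemma lee_poweR (R : realType) (x y : \bar R) (r : R) : 0 <= r ->
  (0 <= x -> x <= y -> x `^ r <= y `^ r)%E.
Proof.
move=> r0 x0 xy; apply: gt0_ler_poweR => //; rewrite in_itv/= leey andbT//.
exact: le_trans xy.
Qed.

Section LpNorm.
Context (R : realType) (k : scalar_kind) (d : measure_display).
Context (T : measurableType d) (mu : {measure set T -> \bar R}).
Implicit Types (D : set T) (r c : R) (f g : T -> scalar_field R k).

Lemma Lp_normE D r f : r != 0 -> Lp_norm mu D r%:E f =
  ((\int[mu]_(t in D) (modulus (f t) `^ r)%:E) `^ r^-1)%E.
Proof.
move=> r0; rewrite /Lp_norm unlock [in RHS]integral_mkcond; congr (_ `^ _)%E.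
apply: eq_integral => t _; rewrite /patch; case: ifP => _ /=.
  by rewrite ger0_norm ?modulus_ge0.
(* Outside [D] the extended function is 0, and its power is 0 only because the exponent is nonzero:
   0 to the power 0 is 1. *)
by rewrite normr0 powR0.
Qed.

Lemma integral_modulus_powR_ge0 D r f :
  (0 <= \int[mu]_(t in D) (modulus (f t) `^ r)%:E)%E.
Proof. by apply: integral_ge0 => t _; rewrite lee_fin powR_ge0. Qed.

Lemma Lp_norm_leP D r f c : 0 < r -> 0 <= c ->
  (Lp_norm mu D r%:E f <= c%:E)%E <->
  (\int[mu]_(t in D) (modulus (f t) `^ r)%:E <= (c `^ r)%:E)%E.
Proof.
move=> r0 c0; rewrite Lp_normE ?gt_eqF//.
have := integral_modulus_powR_ge0 D r f; set I := integral _ _ _ => I0.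
split=> h.
  rewrite -(poweRe1 I0) -(mulVf (negbT (gt_eqF r0))) poweRrM -poweR_EFin.
  by rewrite lee_poweR ?poweR_ge0 ?(ltW r0).
rewrite -(powRr1 c0) -(divff (negbT (gt_eqF r0))) powRrM -poweR_EFin.
by rewrite lee_poweR// invr_ge0 ltW.
Qed.

Lemma Lp_norm_ltyP D r f : 0 < r -> (Lp_norm mu D r%:E f < +oo)%E <->
  (\int[mu]_(t in D) (modulus (f t) `^ r)%:E < +oo)%E.
Proof.
move=> r0; rewrite Lp_normE ?gt_eqF//; split; last exact: poweR_lty.
by apply: lty_poweRy; rewrite invr_eq0 gt_eqF.
Qed.

End LpNorm.

(** The two bounds on [I] exclude infinite values, so the extended subtraction is the real one. The
    multiplier [l] may be 0. *)
Lemma complementary_slackness (R : realType) (l a : R) (I : \bar R) :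
  (0 <= I)%E -> (I <= a%:E)%E -> (l%:E * (I - a%:E) = 0)%E ->
  (l%:E * I = (l * a)%:E)%E.
Proof.
case: I => [r| |]//= _ _.
by rewrite -EFinB -!EFinM => -[] /eqP; rewrite mulrBr subr_eq0 => /eqP ->.
Qed.

(** * The extremal function and the filter: signs, measurability, integrals *)

Section Optimality.
Context (R : realType) (k : scalar_kind) (d : measure_display).
Context (T : measurableType d) (mu : {measure set T -> \bar R}).
Context (T0 : set T) (mT0 : measurable T0) (n : nat).
Context (psi : T -> scalar_field R k) (phi : 'I_n -> T -> scalar_field R k).
Hypotheses (mpsi : smeasurable setT psi) (mphi : forall j, smeasurable setT (phi j)).
Context (delta p q lambda0 : R) (lambda : 'I_n -> R).
Hypotheses (delta_gt0 : 0 < delta) (q_ge1 : 1 <= q) (q_lt_p : q < p).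
Hypotheses (lambda0_gt0 : 0 < lambda0) (lambda_ge0 : forall j, 0 <= lambda j).

Let xh := xhat T0 psi phi p q lambda0 lambda.
Let mh := mhat T0 psi phi q lambda.
Let s := sigma phi q lambda.
Let K := q^-1 * p * lambda0.

Let q_gt0 : 0 < q. Proof. exact: lt_le_trans q_ge1. Qed.
Let p_gt0 : 0 < p. Proof. exact: lt_trans q_lt_p. Qed.
Let K_gt0 : 0 < K. Proof. by rewrite !mulr_gt0// invr_gt0. Qed.

Lemma sigma_ge0 t : 0 <= s t.
Proof. by apply: sumr_ge0 => j _; rewrite mulr_ge0// powR_ge0. Qed.

Lemma measurable_sigma : measurable_fun setT s.
Proof.
apply: measurable_sum => j; apply: measurable_funM => //.
exact: measurable_modulus_powR.
Qed.

Lemma xhat_ge0 t : 0 <= xh t.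
Proof. by rewrite /xh /xhat; case: ifP => // _; exact: powR_ge0. Qed.

Lemma measurable_xhat : measurable_fun setT xh.
Proof.
have mg : measurable_fun setT (fun t => (q / (p * lambda0) *
    pospart (modulus (psi t) `^ q - s t)) `^ (p - q)^-1).
  apply: (measurableT_comp (measurable_powR _)).
  apply: measurable_funM => //; apply: measurable_maxr => //.
  apply: measurable_funB; last exact: measurable_sigma.
  exact: measurable_modulus_powR.
have /(measurable_restrictT _ mT0) := measurable_funS measurableT (@subsetT _ T0) mg.
by [].
Qed.

Lemma measurable_xhat_powR r : measurable_fun setT (fun t => xh t `^ r).
Proof. exact: measurableT_comp (measurable_powR _) measurable_xhat. Qed.

(** On [T0] this is the stationarity equation of the root; off [T0] all terms vanish with [xh]. Its
    integral is the q-th power of the norm of psi times [xhat]. *)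
Lemma xhat_stationary t : modulus (psi t) `^ q * xh t `^ q =
  s t * xh t `^ q + K * xh t `^ p.
Proof.
rewrite /xh /xhat; case: ifP => _.
  exact: (multiplier_root_stationary q_ge1 q_lt_p lambda0_gt0 (s t) (powR_ge0 _ _)).
by rewrite !powR0 ?gt_eqF// !mulr0 addr0.
Qed.

Lemma integral_xhat_powR : (\int[mu]_t (xh t `^ p)%:E =
  \int[mu]_(t in T0) (xh t `^ p)%:E)%E.
Proof.
rewrite [RHS]integral_mkcond; apply: eq_integral => t _.
by rewrite /patch; case: ifPn => // tT0; rewrite /xh /xhat (negbTE tT0) powR0 ?gt_eqF.
Qed.

(** Splits the integral into the n constraint integrals. It is used with g = |x|^q for x in W, and
    with g = [xhat]^q, where complementary slackness evaluates the terms. *)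
Lemma integral_sigmaM (g : T -> R) : measurable_fun setT g ->
  (forall t, 0 <= g t) ->
  (\int[mu]_t (s t * g t)%:E =
   \sum_(j < n) (lambda j)%:E * \int[mu]_t (modulus (phi j t) `^ q * g t)%:E)%E.
Proof.
move=> mg g0.
have mF j : measurable_fun setT (fun t => (modulus (phi j t) `^ q * g t)%:E).
  apply/measurable_EFinP/measurable_funM => //; exact: measurable_modulus_powR.
have F0 j t : (0 <= (modulus (phi j t) `^ q * g t)%:E)%E.
  by rewrite lee_fin mulr_ge0// powR_ge0.
under eq_bigr do rewrite -ge0_integralZl_EFin//.
rewrite -ge0_integral_sum//.
- apply: eq_integral => t _; rewrite /s /sigma mulr_suml -sumEFin.
  by apply: eq_bigr => j _; rewrite -mulrA EFinM.
- by move=> j; apply: measurable_funeM.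
- by move=> j t _; rewrite mule_ge0// lee_fin.
Qed.

Lemma mhatE y t : mh y t = if t \in T0 then
  of_real k (pospart (1 - modulus (psi t) `^ (- q) * s t)) * psi t * y t else 0.
Proof.
rewrite /mh /mhat; case: (t \in T0) => //=.
by have [->|] := eqVneq (psi t) 0; rewrite ?mulr0 ?mul0r.
Qed.

Lemma smeasurable_mhat y : smeasurable T0 y -> smeasurable setT (mh y).
Proof.
move=> my; have -> : mh y = fun t => if t \in T0 then
  of_real k (pospart (1 - modulus (psi t) `^ (- q) * s t)) * psi t * y t else 0.
  by apply/funext => t; exact: mhatE.
apply: smeasurable_extend0 => //; apply: smeasurableM => //.
apply: (@smeasurableS _ _ _ _ T0 setT) => //; apply: smeasurableM => //.
apply: smeasurable_of_real; apply: measurable_maxr => //.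
apply: measurable_funB => //; apply: measurable_funM; last exact: measurable_sigma.
exact: measurable_modulus_powR.
Qed.

(** * Upper bound: the error of [mhat] *)

Hypothesis outside : \forall t \ae mu, ~ T0 t -> modulus (psi t) `^ q - s t <= 0.

(** Stated without x in W and without closeness of x and y, and with integrals that may be infinite,
    so that it yields both the error bound and, for x = 0, that [mhat] takes values in L_q. *)
Lemma integral_mhat_error_le x y : smeasurable setT x -> smeasurable T0 y ->
  (\int[mu]_t (modulus (psi t * x t - mh y t) `^ q)%:E <=
   \int[mu]_t (s t * modulus (x t) `^ q)%:E +
   K%:E * ((1 - q / p)%:E * \int[mu]_(t in T0) (xh t `^ p)%:E +
     (q / p)%:E * \int[mu]_(t in T0) (modulus (x t - y t) `^ p)%:E))%E.
Proof.
move=> mx my.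
have qp0 : 0 <= q / p by rewrite divr_ge0 ?ltW.
have qp1 : 0 <= 1 - q / p by rewrite subr_ge0 ler_pdivrMr// mul1r ltW.
have mxy : measurable_fun T0 (fun t => modulus (x t - y t) `^ p).
  apply: measurable_modulus_powR; apply: smeasurableB => //.
  exact: smeasurableS mx.
have mxh : measurable_fun T0 (fun t => xh t `^ p).
  exact: measurable_funS (measurable_xhat_powR p).
pose G t := K * ((1 - q / p) * xh t `^ p + q / p * modulus (x t - y t) `^ p).
have G0 t : 0 <= G t.
  by rewrite mulr_ge0 ?(ltW K_gt0)// addr_ge0// mulr_ge0// powR_ge0.
have mG : measurable_fun T0 (fun t => (G t)%:E).
  apply/measurable_EFinP/measurable_funM => //.
  by apply: measurable_funD; apply: measurable_funM.
(* The terms over [T0] are gathered into one integral over the whole space, of [G] extended by 0. It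
   then suffices to compare integrands almost everywhere. *)
have -> : (K%:E * ((1 - q / p)%:E * \int[mu]_(t in T0) (xh t `^ p)%:E +
     (q / p)%:E * \int[mu]_(t in T0) (modulus (x t - y t) `^ p)%:E) =
    \int[mu]_t ((EFin \o G) \_ T0) t)%E.
  rewrite -integral_mkcond /G.
  under [RHS]eq_integral do rewrite /= EFinM EFinD !EFinM.
  rewrite ge0_integralZl_EFin ?(ltW K_gt0)//; last 2 first.
  - by move=> t _; rewrite adde_ge0// mule_ge0// lee_fin ?powR_ge0.
  - by apply: emeasurable_funD; apply: measurable_funeM; exact/measurable_EFinP.
  rewrite ge0_integralD//; last 4 first.
  - by move=> t _; rewrite mule_ge0// lee_fin ?powR_ge0.
  - by apply: measurable_funeM; exact/measurable_EFinP.
  - by move=> t _; rewrite mule_ge0// lee_fin ?powR_ge0.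
  - by apply: measurable_funeM; exact/measurable_EFinP.
  rewrite !ge0_integralZl_EFin//.
  - by move=> t _; rewrite lee_fin powR_ge0.
  - exact/measurable_EFinP.
  - by move=> t _; rewrite lee_fin powR_ge0.
  - exact/measurable_EFinP.
have msx : measurable_fun setT (fun t => (s t * modulus (x t) `^ q)%:E).
  apply/measurable_EFinP/measurable_funM; first exact: measurable_sigma.
  exact: measurable_modulus_powR.
have sx0 t : (0 <= (s t * modulus (x t) `^ q)%:E)%E.
  by rewrite lee_fin mulr_ge0 ?sigma_ge0// powR_ge0.
have GT0 t : (0 <= ((EFin \o G) \_ T0) t)%E.
  by apply: erestrict_ge0 => u _; rewrite lee_fin.
have mGT : measurable_fun setT ((EFin \o G) \_ T0).
  exact/(measurable_restrictT _ mT0).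
rewrite -ge0_integralD//.
apply: ae_ge0_le_integral => //.
- by move=> t _; rewrite lee_fin powR_ge0.
- apply/measurable_EFinP; apply: measurable_modulus_powR.
  by apply: smeasurableB; [exact: smeasurableM|exact: smeasurable_mhat].
- by move=> t _; rewrite adde_ge0.
- exact: emeasurable_funD.
apply: filterS outside => t ht _; rewrite mhatE /patch.
case: ifPn => tT0 /=.
  rewrite -EFinD lee_fin.
  apply: le_trans (modulus_filtered_error (psi t) (x t) (y t) q_ge1 (sigma_ge0 t)) _.
  rewrite lerD2l; have := multiplier_young q_ge1 q_lt_p lambda0_gt0
    (pospart_ge0 (modulus (psi t) `^ q - s t)) (modulus_ge0 (x t - y t)).
  by rewrite /G /xh /xhat tT0.
(* Off [T0] the method returns 0, so the error is psi x itself, and [outside] gives |psi|^q <=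
   sigma. *)
rewrite subr0 adde0 lee_fin modulusM powRM ?modulus_ge0//.
rewrite ler_wpM2r ?powR_ge0// -subr_le0.
by apply: ht; move: tT0; rewrite notin_setE.
Qed.

Hypothesis feas0 : (\int[mu]_(t in T0) (xh t `^ p)%:E <= (delta `^ p)%:E)%E.

Lemma mhat_is_method : is_method mu T0 p%:E q%:E mh.
Proof.
split=> [y [my /(Lp_norm_ltyP _ _ _ p_gt0) yfin]|y1 y2 _ _].
  split; first exact: smeasurable_mhat.
  apply/(Lp_norm_ltyP _ _ _ q_gt0).
  (* Up to sign, [mh y] is the recovery error at x = 0, so the error bound controls its norm. *)
  have -> : (\int[mu]_t (modulus (mh y t) `^ q)%:E =
      \int[mu]_t (modulus (psi t * 0 - mh y t) `^ q)%:E)%E.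
    by apply: eq_integral => t _; rewrite mulr0 sub0r modulusN.
  apply: le_lt_trans (integral_mhat_error_le (@smeasurable0 _ k _ _ setT) my) _.
  rewrite integral0_eq ?add0e; last first.
    by move=> t _; rewrite modulus0 powR0 ?mulr0 ?gt_eqF.
  have -> : (\int[mu]_(t in T0) (modulus (0 - y t) `^ p)%:E =
      \int[mu]_(t in T0) (modulus (y t) `^ p)%:E)%E.
    by apply: eq_integral => t _; rewrite sub0r modulusN.
  have fin1 : (\int[mu]_(t in T0) (xh t `^ p)%:E < +oo)%E.
    exact: le_lt_trans feas0 (ltry _).
  apply: lte_mul_pinfty; rewrite ?lee_fin ?(ltW K_gt0)//.
  have qp0 : 0 <= q / p by rewrite divr_ge0 ?ltW.
  have qp1 : 0 <= 1 - q / p by rewrite subr_ge0 ler_pdivrMr// mul1r ltW.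
  apply: lte_add_pinfty.
    by apply: (lte_mul_pinfty _ _ fin1); rewrite ?lee_fin.
  by apply: (lte_mul_pinfty _ _ yfin); rewrite ?lee_fin.
(* The value of [mh y] at t depends on y only through y(t), and only for t in [T0]. *)
apply: filterS => t y12 _; rewrite !mhatE.
by case: ifPn => // /set_mem/y12 ->.
Qed.

Let V := K * delta `^ p + \sum_(j < n) lambda j.

Let V_ge0 : 0 <= V.
Proof.
by rewrite addr_ge0 ?sumr_ge0// mulr_ge0 ?powR_ge0 ?(ltW K_gt0).
Qed.

(** In the integrated bound, membership in W bounds the sigma term by the sum of the [lambda j], and
    the two p-th power integrals are each at most delta^p, by [feas0] and by the accuracy of the
    data. *)
Lemma mhat_error_le :
  (method_error mu T0 psi phi delta p%:E q%:E q%:E mh <= (V `^ q^-1)%:E)%E.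
Proof.
apply: ge_ereal_sup => _ [x [y [[[mx _ _] Wx] [my _] xy ->]]].
apply/(Lp_norm_leP _ _ _ q_gt0 (powR_ge0 _ _)).
rewrite -powRrM mulVf ?gt_eqF// powRr1//.
apply: le_trans (integral_mhat_error_le mx my) _.
move/(Lp_norm_leP _ _ _ p_gt0 (ltW delta_gt0)) : xy => xy.
have qp0 : 0 <= q / p by rewrite divr_ge0 ?ltW.
have qp1 : 0 <= 1 - q / p by rewrite subr_ge0 ler_pdivrMr// mul1r ltW.
rewrite /V (addrC (K * _)) [leRHS]EFinD; apply: leeD.
  rewrite integral_sigmaM; [|exact: measurable_modulus_powR|by move=> t; exact: powR_ge0].
  rewrite -sumEFin; apply: lee_sum => j _.
  rewrite -[leRHS]mule1 lee_wpmul2l ?lee_fin//.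
  have := Wx j => /(Lp_norm_leP _ _ _ q_gt0 ler01); rewrite powR1.
  congr (_ <= _)%E; apply: eq_integral => t _.
  by rewrite modulusM powRM ?modulus_ge0.
rewrite [leRHS]EFinM lee_wpmul2l ?lee_fin ?(ltW K_gt0)//.
(* The Young weights 1 - q/p and q/p add up to 1, so delta^p splits to match the two integrals. *)
have -> : ((delta `^ p)%:E = (1 - q / p)%:E * (delta `^ p)%:E +
    (q / p)%:E * (delta `^ p)%:E)%E.
  by rewrite -!EFinM -EFinD -mulrDl subrK mul1r.
by apply: leeD; (apply: lee_wpmul2l; first by rewrite lee_fin);
  [exact: feas0|exact: xy].
Qed.

(** * Lower bound: the error of an arbitrary method *)

Hypothesis feas : forall j,
  (\int[mu]_t (modulus (phi j t) `^ q * xh t `^ q)%:E <= 1)%E.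
Hypothesis slack0 : (lambda0%:E *
  (\int[mu]_(t in T0) (xh t `^ p)%:E - (delta `^ p)%:E) = 0)%E.
Hypothesis slack : forall j, ((lambda j)%:E *
  (\int[mu]_t (modulus (phi j t) `^ q * xh t `^ q)%:E - 1) = 0)%E.

(** Integrating the stationarity equation leaves the constraint integrals weighted by their
    multipliers; complementary slackness replaces each by its bound, 1 or delta^p. *)
Lemma integral_psi_xhat :
  (\int[mu]_t (modulus (psi t) `^ q * xh t `^ q)%:E = V%:E)%E.
Proof.
under eq_integral do rewrite xhat_stationary EFinD EFinM.
have m1 r : measurable_fun setT (fun t => (xh t `^ r)%:E).
  exact/measurable_EFinP/measurable_xhat_powR.
have ms : measurable_fun setT (fun t => (s t * xh t `^ q)%:E).
  apply/measurable_EFinP/measurable_funM; first exact: measurable_sigma.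
  exact: measurable_xhat_powR.
under eq_integral do rewrite -EFinM (EFinM K).
rewrite ge0_integralD//; last 3 first.
- by move=> t _; rewrite lee_fin mulr_ge0 ?sigma_ge0 ?powR_ge0.
- by move=> t _; rewrite mule_ge0// lee_fin ?powR_ge0 ?(ltW K_gt0).
- exact: measurable_funeM.
rewrite ge0_integralZl_EFin ?(ltW K_gt0)//; last first.
  by move=> t _; rewrite lee_fin powR_ge0.
rewrite integral_xhat_powR integral_sigmaM; last 2 first.
- exact: measurable_xhat_powR.
- by move=> t; exact: powR_ge0.
rewrite /V (addrC (K * _)) EFinD; congr (_ + _)%E.
  rewrite -sumEFin; apply: eq_bigr => j _.
  rewrite -[in RHS](mulr1 (lambda j)); apply: complementary_slackness => //.
  by apply: integral_ge0 => t _; rewrite lee_fin mulr_ge0// powR_ge0.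
rewrite /K EFinM -muleA (complementary_slackness _ feas0 slack0); last first.
  by apply: integral_ge0 => t _; rewrite lee_fin powR_ge0.
by rewrite -EFinM !mulrA.
Qed.

(** Membership depends only on the modulus, so [xhat] and its negative are handled together. *)
Lemma classW_xhat (f : T -> scalar_field R k) : smeasurable setT f ->
  (forall t, modulus (f t) = xh t) -> classW mu T0 phi p%:E q%:E f.
Proof.
move=> mf fE.
have fphi j : (Lp_norm mu setT q%:E (fun t => phi j t * f t)%R <= 1)%E.
  apply/(Lp_norm_leP _ _ _ q_gt0 ler01); rewrite powR1.
  move: (feas j); congr (_ <= _)%E; apply: eq_integral => t _.
  by rewrite modulusM fE powRM ?modulus_ge0 ?xhat_ge0.
split=> //; split=> //.
  split; first exact: smeasurableS mf.
  apply/(Lp_norm_ltyP _ _ _ p_gt0).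
  under eq_integral do rewrite fE.
  exact: le_lt_trans feas0 (ltry _).
by move=> j; apply: le_lt_trans (fphi j) (ltry _).
Qed.

(* The data [y = 0] is compatible with both [xhat] and [- xhat], so the method
   errs by at least half of [2 * psi * xhat] on one of them. *)
Lemma method_error_ge m : is_method mu T0 p%:E q%:E m ->
  ((V `^ q^-1)%:E <= method_error mu T0 psi phi delta p%:E q%:E q%:E m)%E.
Proof.
move=> [mLq _]; pose xs t := of_real k (xh t).
pose z : T -> scalar_field R k := fun=> 0.
have mz D : smeasurable D z by exact: smeasurable0.
have mxs : smeasurable setT xs.
  by apply: smeasurable_of_real; exact: measurable_xhat.
have modxs t : modulus (xs t) = xh t.
  by rewrite modulus_of_real ger0_norm// xhat_ge0.
have z_Lp : in_Lp mu T0 p%:E z.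
  split => //; apply/(Lp_norm_ltyP _ _ _ p_gt0).
  rewrite integral0_eq// => t _; by rewrite modulus0 powR0 ?gt_eqF.
have [mmz _] := mLq z z_Lp.
set e := method_error _ _ _ _ _ _ _ _ _.
have err (f : T -> scalar_field R k) : smeasurable setT f ->
    (forall t, modulus (f t) = xh t) ->
    (Lp_norm mu setT q%:E (fun t => psi t * f t - m z t)%R <= e)%E.
  move=> mf fE; apply: ereal_sup_ubound; exists f, z; split => //.
    exact: classW_xhat.
  apply/(Lp_norm_leP _ _ _ p_gt0 (ltW delta_gt0)).
  under eq_integral do rewrite subr0 fE.
  exact: feas0.
have h1 := err _ mxs modxs.
have h2 := err _ (smeasurableN mxs) (fun t => etrans (modulusN _) (modxs t)).
have e0 : (0 <= e)%E by apply: le_trans h1; exact: Lnorm_ge0.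
(* An infinite error makes the bound trivial, and minus infinity contradicts [e0]; only a real error
   r remains. *)
case: e {err} h1 h2 e0 => [r h1 h2|_ _ _|_ _]; [|exact: leey|by rewrite leeNy_eq].
rewrite lee_fin => r0.
move: h1 h2 => /(Lp_norm_leP _ _ _ q_gt0 r0) h1 /(Lp_norm_leP _ _ _ q_gt0 r0) h2.
rewrite lee_fin -(powRr1 r0) -(divff (negbT (gt_eqF q_gt0))) powRrM.
apply: ge0_ler_powR; rewrite ?nnegrE ?powR_ge0 ?invr_ge0 ?(ltW q_gt0)//.
rewrite -lee_fin -integral_psi_xhat.
set F1 := fun t => modulus (psi t * xs t - m z t) `^ q.
set F2 := fun t => modulus (psi t * - xs t - m z t) `^ q.
have mF1 : measurable_fun setT (fun t => (F1 t)%:E).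
  apply/measurable_EFinP/measurable_modulus_powR/smeasurableB => //.
  exact: smeasurableM.
have mF2 : measurable_fun setT (fun t => (F2 t)%:E).
  apply/measurable_EFinP/measurable_modulus_powR/smeasurableB => //.
  by apply: smeasurableM => //; exact: smeasurableN.
have F10 t : (0 <= (F1 t)%:E)%E by rewrite lee_fin powR_ge0.
have F20 t : (0 <= (F2 t)%:E)%E by rewrite lee_fin powR_ge0.
(* The mean of the q-th powers of the two errors lies between the integral of |psi xhat|^q and
   r^q. *)
apply: (@le_trans _ _ (\int[mu]_t (2^-1%:E * ((F1 t)%:E + (F2 t)%:E)))%E).
  apply: ge0_le_integral => //.
  - by move=> t _; rewrite lee_fin mulr_ge0// powR_ge0.
  - apply/measurable_EFinP/measurable_funM; first exact: measurable_modulus_powR.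
    exact: measurable_xhat_powR.
  - by apply: measurable_funeM; exact: emeasurable_funD.
  move=> t _; rewrite -EFinD -EFinM lee_fin -powRM ?modulus_ge0 ?xhat_ge0//.
  apply: ler_powR_half_sum; rewrite ?modulus_ge0 ?mulr_ge0 ?modulus_ge0 ?xhat_ge0//.
  rewrite -(modulusN (psi t * - xs t - m z t)).
  apply: le_trans (ler_modulusD _ _).
  (* The same output [m z] answers both functions, so it cancels in the difference of the errors. *)
  have -> : psi t * xs t - m z t + - (psi t * - xs t - m z t) =
      of_real k 2 * (psi t * xs t).
    (* Writing 2 as 1 - (0 - 1) lets [of_realB], [of_real0] and [of_real1] compute its image. *)
    rewrite -[2]/(1 + 1) -[X in 1 + X]opprK of_realB -[in of_real k (- 1)]sub0r.
    by rewrite of_realB of_real0 of_real1; ring.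
  by rewrite !modulusM modulus_of_real modxs ger0_norm.
rewrite ge0_integralZl_EFin//; last 2 first.
- by move=> t _; rewrite adde_ge0.
- exact: emeasurable_funD.
rewrite ge0_integralD//.
have -> : ((r `^ q)%:E = 2^-1%:E * ((r `^ q)%:E + (r `^ q)%:E))%E.
  by rewrite -EFinD -EFinM; congr EFin; lra.
by apply: lee_wpmul2l; [rewrite lee_fin|exact: leeD].
Qed.

End Optimality.

(** * The optimal error and the optimal method *)

Theorem theorem2 (R : realType) (k : scalar_kind) (d : measure_display)
    (T : measurableType d) (mu : {measure set T -> \bar R})
    (T0 : set T) (mT0 : measurable T0) (T0_neq0 : T0 !=set0)
    (n : nat) (psi : T -> scalar_field R k) (phi : 'I_n -> T -> scalar_field R k)
    (mpsi : smeasurable setT psi) (mphi : forall j, smeasurable setT (phi j))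
    (delta : R) (delta_gt0 : 0 < delta)
    (p q : R) (q_ge1 : 1 <= q) (q_lt_p : q < p)
    (Lambda_Lq : forall x : T -> scalar_field R k,
       calW mu T0 phi p%:E q%:E x ->
       in_Lp mu setT q%:E (fun t => psi t * x t))
    (lambda0 : R) (lambda0_gt0 : 0 < lambda0)
    (lambda : 'I_n -> R) (lambda_ge0 : forall j, 0 <= lambda j)
    (xh := xhat T0 psi phi p q lambda0 lambda)
    (feas0 : (\int[mu]_(t in T0) (xh t `^ p)%:E <= (delta `^ p)%:E)%E)
    (feas : forall j,
       (\int[mu]_t (modulus (phi j t) `^ q * xh t `^ q)%:E <= 1)%E)
    (slack0 :
       (lambda0%:E *
        (\int[mu]_(t in T0) (xh t `^ p)%:E - (delta `^ p)%:E) = 0)%E)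
    (slack : forall j,
       ((lambda j)%:E *
        (\int[mu]_t (modulus (phi j t) `^ q * xh t `^ q)%:E - 1) = 0)%E)
    (outside : \forall t \ae mu, ~ T0 t ->
       modulus (psi t) `^ q - sigma phi q lambda t <= 0) :
  optimal_error mu T0 psi phi delta p%:E q%:E q%:E =
    ((q^-1 * p * lambda0 * delta `^ p + \sum_(j < n) lambda j) `^ q^-1)%:E /\
  optimal_method mu T0 psi phi delta p%:E q%:E q%:E
    (mhat T0 psi phi q lambda).
Proof.
have le_err := mhat_error_le mT0 mpsi mphi delta_gt0 q_ge1 q_lt_p lambda0_gt0
  lambda_ge0 outside feas0.
have ge_err := method_error_ge mT0 mpsi mphi delta_gt0 q_ge1 q_lt_p lambda0_gt0
  lambda_ge0 feas0 feas slack0 slack.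
have mhat_method := mhat_is_method mT0 mpsi mphi q_ge1 q_lt_p lambda0_gt0
  lambda_ge0 outside feas0.
have optE : optimal_error mu T0 psi phi delta p%:E q%:E q%:E =
  ((q^-1 * p * lambda0 * delta `^ p + \sum_(j < n) lambda j) `^ q^-1)%:E.
  (* The infimum is at most the error of [mhat], and the lower bound holds for every competing
     method. *)
  apply/eqP; rewrite eq_le; apply/andP; split.
    by apply: ge_ereal_inf; eexists; [exists (mhat T0 psi phi q lambda)|].
  by apply: le_ereal_inf_tmp => _ [m mm <-]; exact: ge_err.
split=> //; split=> //; rewrite optE.
by apply/eqP; rewrite eq_le le_err ge_err.
Qed.
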